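(* Let $U,T(\cdot)$ be a type-theoretic universe and let $M=(|M|,=_M)$ be any setoid belonging to $U$. Then the set-theoretic universe $V(M)$ of iterative sets with atoms from $M$ is a model of CZFU. The model also verifies that there is a set containing exactly all atoms, that is $$\exists^{\rm S} x.\ \forall z.\ z\in x\Longleftrightarrow {\rm A}(z).$$
   Context: Setting: intensional Martin-Löf type theory with a universe $U$ (decoding $T(\cdot)$) closed under the usual type formers, and inductive (W-)types. Logic is propositions-as-types: propositions are types, $\exists$ is $\Sigma$, $\forall$ is $\Pi$, $\lor$ is $+$, etc. A setoid $M=(|M|,=_M)$ is a type with a (type-valued) equivalence relation. It belongs to $U$ if there is $m:U$ with $|M|=T(m)$ and $e:|M|\to|M|\to U$ such that for all $x,y:|M|$, $x=_My\Leftrightarrow T(e(x,y))$. $V=V(M)$ is the type inductively generated by: if $a:U$ and $f:T(a)\to V$ then $\sup(a,f):V$; if $b:|M|$ then $\mathrm{atom}(b):V$. The equality $=_V$ is the smallest relation such that: (i) if $\forall x{:}T(a).\exists y{:}T(b).f(x)=_Vg(y)$ and $\forall y{:}T(b).\exists x{:}T(a).f(x)=_Vg(y)$, then $\sup(a,f)=_V\sup(b,g)$; (ii) if $a=_Mb$ then $\mathrm{atom}(a)=_V\mathrm{atom}(b)$. Membership: $u\in_V\sup(a,f)$ iff $\exists x{:}T(a).\,u=_Vf(x)$; and $u\in_V\mathrm{atom}(b)$ is false. CZFU is the theory in intuitionistic first-order logic with equality, with a binary predicate $\in$ and a unary predicate ${\rm S}$ (being a set). ${\rm A}(x)$ is $\lnot{\rm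 S}(x)$; $\forall^{\rm S}x\ldots$ is $\forall x.{\rm S}(x)\Rightarrow\ldots$ and $\exists^{\rm S}x\ldots$ is $\exists x.{\rm S}(x)\wedge\ldots$. Formulas in schemes may contain parameters (subject to the usual variable conditions); bounded formulas are those with all quantifiers of the form $\forall x\in y$, $\exists x\in y$. Axioms: (C1) $\forall x.\,{\rm S}(x)\lor{\rm A}(x)$. (C2) $\forall xy.\,y\in x\Rightarrow{\rm S}(x)$. (C3) $\forall^{\rm S}x.\forall^{\rm S}y.(\forall z.\,z\in x\Leftrightarrow z\in y)\Rightarrow x=y$. (C4) Set induction, for any formula $\varphi$: $(\forall x.(\forall y\in x.\,\varphi(y))\Rightarrow\varphi(x))\Rightarrow\forall x.\varphi(x)$. (C5) Union: $\forall^{\rm S}x.\exists^{\rm S}u.(\forall z.\,z\in u\Leftrightarrow(\exists y\in x)\,z\in y)$. (C6) Pairing: $\forall xy.\exists^{\rm S}u.(\forall z.\,z\in u\Leftrightarrow(z=x\lor z=y))$. (C7) Bounded separation, for any bounded $\varphi$: $\forall^{\rm S}u.\exists^{\rm S}v.\forall x.\,x\in v\Leftrightarrow x\in u\wedge\varphi(x)$. (C8) Subset collection, for any formula $\varphi$: $\forall ab.\exists^{\rm S}c.\forall u.\,(\forall x\in a.\exists y\in b.\,\varphi(x,y,u))\Rightarrow\exists d\in c.\,(\forall x\in a.\exists y\in d.\,\varphi(x,y,u))\wedge(\forall y\in d.\exists x\in a.\,\varphi(x,y,u))$. (C9) Strong collection, for any formula $\varphi$: $\forall a.(\forall x\in a.\exists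 y.\varphi(x,y))\Rightarrow\exists^{\rm S}b.(\forall x\in a.\exists y\in b.\,\varphi(x,y))\wedge(\forall y\in b.\exists x\in a.\,\varphi(x,y))$. (C10) Infinity: $\exists^{\rm S}x.\,\emptyset\in x\wedge(\forall y\in x)\,y^+\in x$, where $y^+=\{y,\{y\}\}$. $V(M)$ being a model means that, interpreting the variables as ranging over $V(M)$, $=$ as $=_V$, $\in$ as $\in_V$, ${\rm S}$ as true of every $\sup(a,f)$ and false of every $\mathrm{atom}(b)$, and the logical constants by propositions-as-types, all axioms hold. *)

(* Defs.v *)
From Stdlib Require Import Arith List CRelationClasses.
Import ListNotations.

(** * Universes and setoids *)

(** A universe à la Tarski.  The computation rules of [T], judgmental in type
    theory, are assumed as propositional equalities of types.  Closure under
    W-types is not required. *)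
Record universe := Universe {
  code :> Type;
  T : code -> Type;
  empty_code : code;
  T_empty : T empty_code = (Empty_set : Type);
  unit_code : code;
  T_unit : T unit_code = (unit : Type);
  bool_code : code;
  T_bool : T bool_code = (bool : Type);
  nat_code : code;
  T_nat : T nat_code = (nat : Type);
  sum_code : code -> code -> code;
  T_sum : forall a b, T (sum_code a b) = (T a + T b)%type;
  pi_code : forall a, (T a -> code) -> code;
  T_pi : forall a b, T (pi_code a b) = (forall x : T a, T (b x));
  sigma_code : forall a, (T a -> code) -> code;
  T_sigma : forall a b, T (sigma_code a b) = {x : T a & T (b x)};
  id_code : forall a, T a -> T a -> code;
  T_id : forall a x y, T (id_code a x y) = (x = y : Type)
}.

Arguments T {u} _.

Record setoid := Setoid {
  carrier :> Type;
  seq : crelation carrier;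
  seq_equiv : Equivalence seq
}.

Arguments seq {s} _ _.

Definition belongs_to (M : setoid) (U : universe) : Type :=
  {m : U & ((carrier M = T m) *
            {e : M -> M -> U & forall x y : M, iffT (seq x y) (T (e x y))})%type}.

(** * Iterative sets with atoms *)

Inductive V (U : universe) (M : setoid) : Type :=
| sup (a : U) (f : T a -> V U M)
| atom (b : M).

Arguments sup {U M} a f.
Arguments atom {U M} b.

Inductive eqV {U : universe} {M : setoid} : V U M -> V U M -> Type :=
| eqV_sup (a b : U) (f : T a -> V U M) (g : T b -> V U M) :
    (forall x : T a, {y : T b & eqV (f x) (g y)}) ->
    (forall y : T b, {x : T a & eqV (f x) (g y)}) ->
    eqV (sup a f) (sup b g)
| eqV_atom (a b : M) : seq a b -> eqV (atom a) (atom b).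

Definition memV {U : universe} {M : setoid} (u v : V U M) : Type :=
  match v with
  | sup a f => {x : T a & eqV u (f x)}
  | atom _ => Empty_set
  end.

Definition setV {U : universe} {M : setoid} (u : V U M) : Type :=
  match u with
  | sup _ _ => unit
  | atom _ => Empty_set
  end.

(** * Formulas of the language of set theory with atoms *)

Definition var := nat.

Inductive formula :=
| Eq (x y : var)
| Mem (x y : var)
| IsSet (x : var)
| Bot
| And (φ ψ : formula)
| Or (φ ψ : formula)
| Imp (φ ψ : formula)
| All (x : var) (φ : formula)
| Ex (x : var) (φ : formula).

Declare Scope form_scope.
Delimit Scope form_scope with form.
Bind Scope form_scope with formula.

Definition Not (φ : formula) := Imp φ Bot.
Definition Iff (φ ψ : formula) := And (Imp φ ψ) (Imp ψ φ).
Definition IsAtom (x : var) := Not (IsSet x).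
Definition AllS (x : var) (φ : formula) := All x (Imp (IsSet x) φ).
Definition ExS (x : var) (φ : formula) := Ex x (And (IsSet x) φ).
(** [AllIn x y φ] and [ExIn x y φ] are meant for distinct [x] and [y]. *)
Definition AllIn (x y : var) (φ : formula) := All x (Imp (Mem x y) φ).
Definition ExIn (x y : var) (φ : formula) := Ex x (And (Mem x y) φ).

Notation "x ≐ y" := (Eq x y) (at level 70, no associativity) : form_scope.
Notation "x ∈ y" := (Mem x y) (at level 70, no associativity) : form_scope.
Notation "¬ φ" := (Not φ) (at level 75, right associativity) : form_scope.
Notation "φ ∧ ψ" := (And φ ψ) (at level 80, right associativity) : form_scope.
Notation "φ ∨ ψ" := (Or φ ψ) (at level 85, right associativity) : form_scope.
Notation "φ ⇒ ψ" := (Imp φ ψ) (at level 90, right associativity) : form_scope.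
Notation "φ ⇔ ψ" := (Iff φ ψ) (at level 95, no associativity) : form_scope.
Notation "'∀' x , φ" := (All x φ) (at level 200, x at level 69) : form_scope.
Notation "'∃' x , φ" := (Ex x φ) (at level 200, x at level 69) : form_scope.
Notation "'∀S' x , φ" := (AllS x φ) (at level 200, x at level 69) : form_scope.
Notation "'∃S' x , φ" := (ExS x φ) (at level 200, x at level 69) : form_scope.
Notation "'∀' x '∈' y , φ" := (AllIn x y φ)
  (at level 200, x at level 69, y at level 69) : form_scope.
Notation "'∃' x '∈' y , φ" := (ExIn x y φ)
  (at level 200, x at level 69, y at level 69) : form_scope.

Local Open Scope form_scope.

Fixpoint free (z : var) (φ : formula) : Prop :=
  match φ with
  | x ≐ y | x ∈ y => z = x \/ z = y
  | IsSet x => z = x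
  | Bot => False
  | And φ ψ | Or φ ψ | Imp φ ψ => free z φ \/ free z ψ
  | All x φ | Ex x φ => z <> x /\ free z φ
  end.

Fixpoint occurs (z : var) (φ : formula) : Prop :=
  match φ with
  | x ≐ y | x ∈ y => z = x \/ z = y
  | IsSet x => z = x
  | Bot => False
  | And φ ψ | Or φ ψ | Imp φ ψ => occurs z φ \/ occurs z ψ
  | All x φ | Ex x φ => z = x \/ occurs z φ
  end.

(** [rename x y φ] replaces the free occurrences of [x] in [φ] by [y].  It does
    not avoid capture, and is only used when [y] does not occur in [φ]. *)
Fixpoint rename (x y : var) (φ : formula) : formula :=
  let r z := if Nat.eqb z x then y else z in
  match φ with
  | z ≐ w => r z ≐ r w
  | z ∈ w => r z ∈ r w
  | IsSet z => IsSet (r z)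
  | Bot => Bot
  | And φ ψ => And (rename x y φ) (rename x y ψ)
  | Or φ ψ => Or (rename x y φ) (rename x y ψ)
  | Imp φ ψ => Imp (rename x y φ) (rename x y ψ)
  | All z φ => All z (if Nat.eqb z x then φ else rename x y φ)
  | Ex z φ => Ex z (if Nat.eqb z x then φ else rename x y φ)
  end.

Inductive bounded : formula -> Type :=
| bounded_Eq x y : bounded (x ≐ y)
| bounded_Mem x y : bounded (x ∈ y)
| bounded_IsSet x : bounded (IsSet x)
| bounded_Bot : bounded Bot
| bounded_And φ ψ : bounded φ -> bounded ψ -> bounded (φ ∧ ψ)
| bounded_Or φ ψ : bounded φ -> bounded ψ -> bounded (φ ∨ ψ)
| bounded_Imp φ ψ : bounded φ -> bounded ψ -> bounded (φ ⇒ ψ)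
| bounded_AllIn x y φ : x <> y -> bounded φ -> bounded (∀ x ∈ y, φ)
| bounded_ExIn x y φ : x <> y -> bounded φ -> bounded (∃ x ∈ y, φ).

(** * The theory CZFU *)

(** Each axiom is given for every choice of pairwise distinct bound variables.
    In the schemes [φ] may contain any further free variables as parameters,
    including earlier bound variables; only those excluded by a side condition
    may not occur. *)
Inductive CZFU : formula -> Type :=
| set_or_atom x :
    CZFU (∀ x, IsSet x ∨ IsAtom x)
| only_sets_have_elements x y : NoDup [x; y] ->
    CZFU (∀ x, ∀ y, y ∈ x ⇒ IsSet x)
| extensionality x y z : NoDup [x; y; z] ->
    CZFU (∀S x, ∀S y, (∀ z, z ∈ x ⇔ z ∈ y) ⇒ x ≐ y)
| set_induction x y φ : NoDup [x; y] -> ~ occurs y φ ->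
    CZFU ((∀ x, (∀ y ∈ x, rename x y φ) ⇒ φ) ⇒ ∀ x, φ)
| union x y z u : NoDup [x; y; z; u] ->
    CZFU (∀S x, ∃S u, ∀ z, z ∈ u ⇔ ∃ y ∈ x, z ∈ y)
| pairing x y z u : NoDup [x; y; z; u] ->
    CZFU (∀ x, ∀ y, ∃S u, ∀ z, z ∈ u ⇔ (z ≐ x ∨ z ≐ y))
| bounded_separation u v x φ : NoDup [u; v; x] -> bounded φ -> ~ free v φ ->
    CZFU (∀S u, ∃S v, ∀ x, x ∈ v ⇔ (x ∈ u ∧ φ))
| subset_collection a b c d u x y φ : NoDup [a; b; c; d; u; x; y] ->
    ~ free c φ -> ~ free d φ ->
    CZFU (∀ a, ∀ b, ∃S c, ∀ u,
            (∀ x ∈ a, ∃ y ∈ b, φ) ⇒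
            ∃ d ∈ c, (∀ x ∈ a, ∃ y ∈ d, φ) ∧ (∀ y ∈ d, ∃ x ∈ a, φ))
| strong_collection a b x y φ : NoDup [a; b; x; y] -> ~ free b φ ->
    CZFU (∀ a,
            (∀ x ∈ a, ∃ y, φ) ⇒
            ∃S b, (∀ x ∈ a, ∃ y ∈ b, φ) ∧ (∀ y ∈ b, ∃ x ∈ a, φ))
(** The conjuncts express that x has the empty set as an element and that
    y ∈ x implies {y, {y}} ∈ x; here z is {y, {y}} and v ranges over {y}. *)
| infinity x y z w v t : NoDup [x; y; z; w; v; t] ->
    CZFU (∃S x,
            (∃ z ∈ x, IsSet z ∧ ∀ w, ¬ w ∈ z) ∧
            (∀ y ∈ x, ∃ z ∈ x, IsSet z ∧
               ∀ v, v ∈ z ⇔ (v ≐ y ∨ (IsSet v ∧ ∀ t, t ∈ v ⇔ t ≐ y)))).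

(** The axioms of equality belonging to first-order logic with equality. *)
Inductive equality_axiom : formula -> Type :=
| equality_refl x : equality_axiom (∀ x, x ≐ x)
| equality_subst x y φ : NoDup [x; y] -> ~ occurs y φ ->
    equality_axiom (∀ x, ∀ y, x ≐ y ⇒ φ ⇒ rename x y φ).

(** * Models, with logic interpreted as propositions-as-types *)

Record structure := Structure {
  dom :> Type;
  eqI : dom -> dom -> Type;
  memI : dom -> dom -> Type;
  setI : dom -> Type
}.

Arguments eqI {s} _ _.
Arguments memI {s} _ _.
Arguments setI {s} _.

Definition update {D : Type} (ρ : var -> D) (x : var) (d : D) : var -> D :=
  fun z => if Nat.eqb z x then d else ρ z.

Fixpoint sat {S : structure} (ρ : var -> S) (φ : formula) : Type :=
  match φ with
  | x ≐ y => eqI (ρ x) (ρ y)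
  | x ∈ y => memI (ρ x) (ρ y)
  | IsSet x => setI (ρ x)
  | Bot => Empty_set
  | And φ ψ => (sat ρ φ * sat ρ ψ)%type
  | Or φ ψ => (sat ρ φ + sat ρ ψ)%type
  | Imp φ ψ => sat ρ φ -> sat ρ ψ
  | All x φ => forall d : S, sat (update ρ x d) φ
  | Ex x φ => {d : S & sat (update ρ x d) φ}
  end.

Definition valid (S : structure) (φ : formula) : Type :=
  forall ρ : var -> S, sat ρ φ.

Definition is_model (S : structure) : Type :=
  ((forall φ, equality_axiom φ -> valid S φ) *
   (forall φ, CZFU φ -> valid S φ))%type.

Definition V_structure (U : universe) (M : setoid) : structure :=
  Structure (V U M) eqV memV setV.

(* Main.v *)
(** The axioms asserting existence of sets hold because [U] has the codes needed
    to index the required families: Σ for union and separation, Π for subset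
    collection, booleans and natural numbers for pairing and infinity, [M]
    itself for the set of atoms.  Collection combines this with the choice
    principle that comes for free with ∃ read as Σ.  Separation also needs
    bounded formulas to be equivalent to types in [U]: equality in V is, by
    recursion on its two arguments, as [M] belongs to [U], and a quantifier over
    a set sup(a, f) amounts to a quantifier over T(a). *)

From Stdlib Require Import Arith List CRelationClasses.
Import ListNotations.
Require Import Defs.

Local Open Scope form_scope.

(** * Equality and membership in V *)

(** The cases of [eqV] in computable form: direct inversion on two values of [sup] would leave
    equations between dependent pairs, and the smallness proof needs a type built from Σ, Π and
    products. *)
Definition eqV_unfold {U : universe} {M : setoid} (u v : V U M) : Type :=
  match u, v with
  | sup a f, sup b g =>
      ((forall x : T a, {y : T b & eqV (f x) (g y)}) *
       (forall y : T b, {x : T a & eqV (f x) (g y)}))%type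
  | atom a, atom b => seq a b
  | _, _ => Empty_set
  end.

Lemma eqV_unfoldP {U : universe} {M : setoid} (u v : V U M) :
  iffT (eqV u v) (eqV_unfold u v).
Proof.
  split.
  - intros [a b f g H1 H2 | a b H]; [exact (H1, H2) | exact H].
  - destruct u, v; cbn; try easy.
    + intros [H1 H2]; now constructor.
    + now constructor.
Qed.

Lemma eqV_refl {U : universe} {M : setoid} (u : V U M) : eqV u u.
Proof.
  induction u as [a f IH | b]; constructor; eauto.
  apply (seq_equiv M).
Qed.

Lemma eqV_sym {U : universe} {M : setoid} (u v : V U M) : eqV u v -> eqV v u.
Proof.
  revert v; induction u as [a f IH | b]; intros [a' f' | b'] H;
    apply eqV_unfoldP in H; cbn in H; try easy; constructor.
  - intros y; destruct (snd H y) as [x E]; eauto.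
  - intros x; destruct (fst H x) as [y E]; eauto.
  - now apply (seq_equiv M).
Qed.

Lemma eqV_trans {U : universe} {M : setoid} (u v w : V U M) :
  eqV u v -> eqV v w -> eqV u w.
Proof.
  revert v w; induction u as [a f IH | b]; intros [a' f' | b'] [a'' f'' | b''] H K;
    apply eqV_unfoldP in H, K; cbn in H, K; try easy; constructor.
  - intros x; destruct (fst H x) as [y E], (fst K y) as [z F]; eauto.
  - intros z; destruct (snd K z) as [y F], (snd H y) as [x E]; eauto.
  - now apply (seq_equiv M) with b'.
Qed.

Lemma memV_eqV {U : universe} {M : setoid} (u u' v v' : V U M) :
  eqV u u' -> eqV v v' -> memV u v -> memV u' v'.
Proof.
  intros Hu Hv; apply eqV_unfoldP in Hv; destruct v as [a f | b], v' as [a' f' | b'];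
    cbn in *; try easy.
  intros [x E]; destruct (fst Hv x) as [y F]; exists y.
  apply eqV_trans with u; [now apply eqV_sym|]; now apply eqV_trans with (f x).
Qed.

Lemma setV_eqV {U : universe} {M : setoid} (u v : V U M) :
  eqV u v -> setV u -> setV v.
Proof. now intros []. Qed.

Lemma memV_setV {U : universe} {M : setoid} (u v : V U M) : memV u v -> setV v.
Proof. now destruct v. Qed.

(** Each [f x] is a member of [sup a f] by reflexivity, so equal membership yields the two matching
    clauses of [eqV]. The [setV] hypotheses exclude atoms, which have no members either. *)
Lemma eqV_ext {U : universe} {M : setoid} (u v : V U M) :
  setV u -> setV v -> (forall w, iffT (memV w u) (memV w v)) -> eqV u v.
Proof.
  destruct u as [a f | a], v as [b g | b]; cbn; try easy; intros _ _ H; constructor.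
  - intros x; apply (H (f x)); exists x; apply eqV_refl.
  - intros y; destruct (snd (H (g y))) as [x E]; [exists y; apply eqV_refl|].
    exists x; now apply eqV_sym.
Qed.

(** * Members by index, and sets built from families *)

Definition index {U : universe} {M : setoid} (u : V U M) : U :=
  match u with sup a _ => a | atom _ => empty_code U end.

(** Since [index] is empty on atoms, membership takes one form for sets and atoms alike; the value
    [atom b] is a placeholder that no index ever reaches. *)
Definition element {U : universe} {M : setoid} (u : V U M) : T (index u) -> V U M :=
  match u with
  | sup _ f => f
  | atom b => fun _ => atom b
  end.

Lemma memV_element {U : universe} {M : setoid} (u v : V U M) :
  iffT (memV u v) {i : T (index v) & eqV u (element v i)}.
Proof.
  destruct v as [a f | b]; cbn; [easy|].
  split; [easy|]; intros [i _]; rewrite T_empty in i; easy.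
Qed.

Lemma element_memV {U : universe} {M : setoid} (v : V U M) (i : T (index v)) :
  memV (element v i) v.
Proof. apply memV_element; exists i; apply eqV_refl. Qed.

(** Codes decode to the intended types only up to a propositional equation. Eliminating it once, for
    a variable [A], lets later sets be indexed by [bool], [nat], Σ-types and Π-types without visible
    transports. *)
Lemma family_set {U : universe} {M : setoid} {A : Type} {c : U} (e : T c = A)
    (f : A -> V U M) :
  {v : V U M & (setV v * forall u, iffT (memV u v) {x : A & eqV u (f x)})%type}.
Proof. destruct e; now exists (sup c f). Qed.

Definition pairV {U : universe} {M : setoid} (u v : V U M) : V U M :=
  projT1 (family_set (T_bool U) (fun b : bool => if b then u else v)).

Lemma setV_pairV {U : universe} {M : setoid} (u v : V U M) : setV (pairV u v).
Proof. apply (projT2 (family_set _ _)). Qed.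

Lemma memV_pairV {U : universe} {M : setoid} (u v w : V U M) :
  iffT (memV w (pairV u v)) (eqV w u + eqV w v).
Proof.
  unfold pairV; destruct (family_set _ _) as [p [Hp H]]; cbn.
  split.
  - intros K; apply H in K as [[] E]; [now left | now right].
  - intros [E | E]; apply H; [now exists true | now exists false].
Qed.

Definition emptyV {U : universe} {M : setoid} : V U M :=
  projT1 (family_set (T_empty U) (fun i : Empty_set => match i with end)).

Lemma setV_emptyV {U : universe} {M : setoid} : setV (@emptyV U M).
Proof. apply (projT2 (family_set _ _)). Qed.

Lemma memV_emptyV {U : universe} {M : setoid} (u : V U M) : memV u emptyV -> Empty_set.
Proof.
  unfold emptyV; destruct (family_set _ _) as [p [Hp H]]; cbn.
  intros K; now apply H in K as [].
Qed.

(** The successor is [{y, {y}}], as in the axiom of infinity, with the singleton as a pair of equal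
    entries. *)
Fixpoint numeral {U : universe} {M : setoid} (n : nat) : V U M :=
  match n with
  | 0 => emptyV
  | S n => pairV (numeral n) (pairV (numeral n) (numeral n))
  end.

(** * Satisfaction *)

Lemma update_same {D : Type} (ρ : var -> D) x d : update ρ x d x = d.
Proof. unfold update; now rewrite Nat.eqb_refl. Qed.

Lemma update_other {D : Type} (ρ : var -> D) x y d : y <> x -> update ρ x d y = ρ y.
Proof. intros H; apply Nat.eqb_neq in H; unfold update; now rewrite H. Qed.

Ltac distinct :=
  repeat match goal with
  | H : NoDup (_ :: _) |- _ =>
      let ne := fresh "ne" in apply NoDup_cons_iff in H as [ne H]; cbn [In] in *
  | H : ~ (_ \/ _) |- _ =>
      let ne := fresh "ne" in apply Decidable.not_or in H as [ne H]
  | H : NoDup [] |- _ => clear H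
  | H : ~ False |- _ => clear H
  end.

Ltac lookup :=
  repeat match goal with
  | |- context [update ?r ?x ?d ?x] => rewrite (update_same r x d)
  | H : context [update ?r ?x ?d ?x] |- _ => rewrite (update_same r x d) in H
  | |- context [update ?r ?x ?d ?y] =>
      rewrite (update_other r x y d) by (assumption || now apply not_eq_sym)
  | H : context [update ?r ?x ?d ?y] |- _ =>
      rewrite (update_other r x y d) in H by (assumption || now apply not_eq_sym)
  end.

Ltac unfold_sat :=
  cbn [sat AllIn ExIn AllS ExS Iff IsAtom Not V_structure dom eqI memI setI] in *.

(** Serves both to replace values by [eqV]-equal ones and to change the values of variables that are
    not free. Under a quantifier both assignments receive the same new value, so reflexivity covers
    the bound variable. *)
Lemma sat_eqV {U : universe} {M : setoid} (φ : formula) (ρ ρ' : var -> V_structure U M) :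
  (forall z, free z φ -> eqV (ρ z) (ρ' z)) -> iffT (sat ρ φ) (sat ρ' φ).
Proof.
  revert ρ ρ'; induction φ as [x y | x y | x | | φ IH1 ψ IH2 | φ IH1 ψ IH2 | φ IH1 ψ IH2
    | x φ IH | x φ IH]; intros ρ ρ' E; cbn in E |- *.
  1-2: assert (Ex : eqV (ρ x) (ρ' x)) by auto; assert (Ey : eqV (ρ y) (ρ' y)) by auto;
    assert (Ex' := eqV_sym _ _ Ex); assert (Ey' := eqV_sym _ _ Ey).
  - split; intros H; eauto using eqV_trans.
  - split; apply memV_eqV; assumption.
  - assert (Ex : eqV (ρ x) (ρ' x)) by auto; split; apply setV_eqV; auto using eqV_sym.
  - easy.
  - destruct (IH1 ρ ρ'), (IH2 ρ ρ'); auto; split; intros []; auto.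
  - destruct (IH1 ρ ρ'), (IH2 ρ ρ'); auto; split; intros []; auto.
  - destruct (IH1 ρ ρ'), (IH2 ρ ρ'); auto; split; auto.
  - assert (K : forall d, iffT (sat (update ρ x d) φ) (sat (update ρ' x d) φ)).
    { intros d; apply IH; intros z Hz; unfold update.
      destruct (Nat.eqb_spec z x); [apply eqV_refl | auto]. }
    split; intros H d; apply K, H.
  - assert (K : forall d, iffT (sat (update ρ x d) φ) (sat (update ρ' x d) φ)).
    { intros d; apply IH; intros z Hz; unfold update.
      destruct (Nat.eqb_spec z x); [apply eqV_refl | auto]. }
    split; intros [d H]; exists d; apply K, H.
Qed.

(** Compares the two assignments variable by variable; clashes with distinctness or non-freeness
    hypotheses close the impossible cases. *)
Ltac transport_sat H :=
  refine (fst (sat_eqV _ _ _ _) H);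
  let w := fresh "w" in let Hw := fresh "Hw" in
  intros w Hw; unfold update;
  repeat match goal with
  | |- context [Nat.eqb w ?x] => destruct (Nat.eqb_spec w x)
  end;
  subst; try contradiction; auto using eqV_refl, eqV_sym.

Lemma sat_rename {U : universe} {M : setoid} (φ : formula) (x y : var)
    (ρ : var -> V_structure U M) :
  ~ occurs y φ -> iffT (sat ρ (rename x y φ)) (sat (update ρ x (ρ y)) φ).
Proof.
  revert ρ; induction φ as [v w | v w | v | | φ IH1 ψ IH2 | φ IH1 ψ IH2 | φ IH1 ψ IH2
    | v φ IH | v φ IH]; intros ρ Hy; cbn in Hy |- *.
  - unfold update; now destruct (Nat.eqb v x), (Nat.eqb w x).
  - unfold update; now destruct (Nat.eqb v x), (Nat.eqb w x).
  - unfold update; now destruct (Nat.eqb v x).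
  - easy.
  - destruct (IH1 ρ), (IH2 ρ); auto; split; intros []; auto.
  - destruct (IH1 ρ), (IH2 ρ); auto; split; intros []; auto.
  - destruct (IH1 ρ), (IH2 ρ); auto; split; auto.
  - assert (K : forall d, iffT (sat (update ρ v d) (if Nat.eqb v x then φ else rename x y φ))
                  (sat (update (update ρ x (ρ y)) v d) φ)).
    { intros d; distinct; destruct (Nat.eqb_spec v x) as [->|].
      (* Here [v] is [x]: renaming stops at the binder, and the update by [d] hides the earlier
         value of [x]. *)
      - split; intros H; transport_sat H.
      (* Otherwise the updates at [v] and [x] commute, and [y], being different from [v], still has
         the value [ρ y]. *)
      - destruct (IH (update ρ v d)) as [K1 K2]; [assumption|]; lookup.
        split; intros H; [apply K1 in H | apply K2]; transport_sat H. }
    split; intros H d; apply K, H.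
  - assert (K : forall d, iffT (sat (update ρ v d) (if Nat.eqb v x then φ else rename x y φ))
                  (sat (update (update ρ x (ρ y)) v d) φ)).
    { intros d; distinct; destruct (Nat.eqb_spec v x) as [->|].
      - split; intros H; transport_sat H.
      - destruct (IH (update ρ v d)) as [K1 K2]; [assumption|]; lookup.
        split; intros H; [apply K1 in H | apply K2]; transport_sat H. }
    split; intros [d H]; exists d; apply K, H.
Qed.

(** Every member of [ρ y] is [eqV]-equal to some [element (ρ y) i], and satisfaction respects [eqV].
    As [x <> y], binding [x] does not alter the bounding set. *)
Lemma sat_AllIn {U : universe} {M : setoid} (x y : var) (φ : formula)
    (ρ : var -> V_structure U M) : x <> y ->
  iffT (sat ρ (∀ x ∈ y, φ))
       (forall i : T (index (ρ y)), sat (update ρ x (element (ρ y) i)) φ).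
Proof.
  intros N; unfold_sat; split.
  - intros H i; apply H; lookup; apply element_memV.
  - intros H d K; lookup; apply memV_element in K as [i E].
    specialize (H i); transport_sat H.
Qed.

Lemma sat_ExIn {U : universe} {M : setoid} (x y : var) (φ : formula)
    (ρ : var -> V_structure U M) : x <> y ->
  iffT (sat ρ (∃ x ∈ y, φ))
       {i : T (index (ρ y)) & sat (update ρ x (element (ρ y) i)) φ}.
Proof.
  intros N; unfold_sat; split.
  - intros [d [K H]]; lookup; apply memV_element in K as [i E].
    exists i; transport_sat H.
  - intros [i H]; exists (element (ρ y) i); split; [lookup; apply element_memV | exact H].
Qed.

(** * Smallness of bounded formulas *)

(** Logical equivalence suffices because only inhabitation matters for satisfaction; it is also all
    that [belongs_to] provides for [seq]. *)
Definition small (U : universe) (A : Type) : Type := {c : U & iffT A (T c)}.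

Lemma small_iffT (U : universe) (A B : Type) : iffT A B -> small U A -> small U B.
Proof. intros [f g] [c [h k]]; exists c; split; auto. Qed.

Lemma small_empty (U : universe) : small U Empty_set.
Proof. exists (empty_code U); rewrite T_empty; easy. Qed.

Lemma small_unit (U : universe) : small U unit.
Proof. exists (unit_code U); rewrite T_unit; easy. Qed.

Lemma small_sum (U : universe) (A B : Type) : small U A -> small U B -> small U (A + B).
Proof.
  intros [a [f f']] [b [g g']]; exists (sum_code U a b); rewrite T_sum.
  split; intros []; auto.
Qed.

Lemma small_pi (U : universe) (a : U) (B : T a -> Type) :
  (forall x, small U (B x)) -> small U (forall x, B x).
Proof.
  intros H; exists (pi_code U a (fun x => projT1 (H x))); rewrite T_pi.
  split; intros f x; apply (projT2 (H x)), f.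
Qed.

Lemma small_sigma (U : universe) (a : U) (B : T a -> Type) :
  (forall x, small U (B x)) -> small U {x : T a & B x}.
Proof.
  intros H; exists (sigma_code U a (fun x => projT1 (H x))); rewrite T_sigma.
  split; intros [x y]; exists x; apply (projT2 (H x)), y.
Qed.

Lemma small_fun (U : universe) (A B : Type) : small U A -> small U B -> small U (A -> B).
Proof.
  intros [a [f f']] HB; apply small_iffT with (T a -> B); [split; auto|].
  now apply small_pi.
Qed.

Lemma small_prod (U : universe) (A B : Type) : small U A -> small U B -> small U (A * B).
Proof.
  intros [a [f f']] HB; apply small_iffT with {_ : T a & B}.
  - split; intros [x y]; eauto.
  - now apply small_sigma.
Qed.

Lemma small_eqV {U : universe} {M : setoid} (HM : belongs_to M U) (u v : V U M) :
  small U (eqV u v).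
Proof.
  revert v; induction u as [a f IH | a]; intros v;
    (eapply small_iffT; [symmetry; apply eqV_unfoldP|]); destruct v as [b g | b]; cbn; try apply small_empty.
  (* Both clauses compare some [f x] with some [g y], so induction on [u] with [v] general is
     enough. *)
  - apply small_prod; apply small_pi; intros x; apply small_sigma; auto.
  - destruct HM as (m & _ & e & He); exists (e a b); apply He.
Qed.

Lemma small_memV {U : universe} {M : setoid} (HM : belongs_to M U) (u v : V U M) :
  small U (memV u v).
Proof.
  destruct v; cbn; [|apply small_empty].
  apply small_sigma; auto using small_eqV.
Qed.

Lemma small_setV {U : universe} {M : setoid} (u : V U M) : small U (setV u).
Proof. destruct u; [apply small_unit | apply small_empty]. Qed.

Lemma small_bounded {U : universe} {M : setoid} (HM : belongs_to M U) (φ : formula) :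
  bounded φ -> forall ρ : var -> V_structure U M, small U (sat ρ φ).
Proof.
  induction 1; intros ρ.
  - now apply small_eqV.
  - now apply small_memV.
  - apply small_setV.
  - apply small_empty.
  - apply small_prod; auto.
  - apply small_sum; auto.
  - apply small_fun; auto.
  - eapply small_iffT; [symmetry; now apply sat_AllIn | apply small_pi; auto].
  - eapply small_iffT; [symmetry; now apply sat_ExIn | apply small_sigma; auto].
Qed.

(** * The axioms *)

Lemma valid_equality (U : universe) (M : setoid) (φ : formula) :
  equality_axiom φ -> valid (V_structure U M) φ.
Proof.
  intros [x | x y ψ N Hy] ρ; unfold_sat.
  - intros d; apply eqV_refl.
  (* By [sat_rename] the goal evaluates [x] at [e] instead of [d], and these are [eqV]-equal. *)
  - intros d e; distinct; lookup; intros E H; apply sat_rename; [assumption|].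
    lookup; transport_sat H.
Qed.

Lemma valid_extensionality (U : universe) (M : setoid) (x y z : var) : NoDup [x; y; z] ->
  valid (V_structure U M) (∀S x, ∀S y, (∀ z, z ∈ x ⇔ z ∈ y) ⇒ x ≐ y).
Proof.
  intros N ρ; distinct; unfold_sat; intros u Hu v Hv H; lookup.
  apply eqV_ext; [assumption..|]; intros w; specialize (H w); lookup; exact H.
Qed.

(** Structural induction on [V]. A member of [sup a f] is only [eqV]-equal to some [f i], so the
    induction hypothesis is transported; for an atom the premise about members is vacuous. *)
Lemma valid_set_induction (U : universe) (M : setoid) (x y : var) (φ : formula) :
  NoDup [x; y] -> ~ occurs y φ ->
  valid (V_structure U M) ((∀ x, (∀ y ∈ x, rename x y φ) ⇒ φ) ⇒ ∀ x, φ).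
Proof.
  intros N Hy ρ; distinct; unfold_sat; intros H u.
  assert (Fy : ~ free y φ) by (contradict Hy; clear -Hy; induction φ; cbn in *; tauto).
  induction u as [a f IH | b]; apply H; intros d K; lookup; cbn in K; [|easy].
  destruct K as [i E]; apply sat_rename; [assumption|]; lookup.
  specialize (IH i); transport_sat IH.
Qed.

Lemma valid_union (U : universe) (M : setoid) (x y z u : var) : NoDup [x; y; z; u] ->
  valid (V_structure U M) (∀S x, ∃S u, ∀ z, z ∈ u ⇔ ∃ y ∈ x, z ∈ y).
Proof.
  intros N ρ; distinct; unfold_sat; intros a _.
  (* Indices are pairs of an index of [a] and an index of the member it selects; atoms in [a]
     contribute nothing, their index type being empty. *)
  destruct (family_set (T_sigma U (index a) (fun i => index (element a i)))
    (fun p => element (element a (projT1 p)) (projT2 p))) as [v [Hv H]].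
  exists v; lookup; split; [exact Hv|]; intros w; lookup; split.
  - intros K; apply H in K as [[i j] E]; exists (element a i); lookup.
    split; [apply element_memV|]; apply memV_element; now exists j.
  - intros [b [Hb Hw]]; lookup; apply memV_element in Hb as [i E].
    assert (K : memV w (element a i)) by (eapply memV_eqV; eauto using eqV_refl).
    apply memV_element in K as [j F]; apply H; now exists (existT _ i j).
Qed.

Lemma valid_pairing (U : universe) (M : setoid) (x y z u : var) : NoDup [x; y; z; u] ->
  valid (V_structure U M) (∀ x, ∀ y, ∃S u, ∀ z, z ∈ u ⇔ (z ≐ x ∨ z ≐ y)).
Proof.
  intros N ρ; distinct; unfold_sat; intros a b; exists (pairV a b); lookup.
  split; [apply setV_pairV|]; intros w; lookup; apply memV_pairV.
Qed.

Lemma valid_bounded_separation (U : universe) (M : setoid) (HM : belongs_to M U)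
    (u v x : var) (φ : formula) : NoDup [u; v; x] -> bounded φ -> ~ free v φ ->
  valid (V_structure U M) (∀S u, ∃S v, ∀ x, x ∈ v ⇔ (x ∈ u ∧ φ)).
Proof.
  intros N B Fv ρ; distinct; unfold_sat; intros a _.
  (* A code for the truth value of [φ] at each element. The assignment leaves out [v], so the code
     can be chosen before the set assigned to [v] exists. *)
  pose proof (fun i => small_bounded HM φ B (update (update ρ u a) x (element a i))) as S.
  destruct (family_set (T_sigma U (index a) (fun i => projT1 (S i)))
    (fun p => element a (projT1 p))) as [b [Hb H]].
  exists b; lookup; split; [exact Hb|]; intros w; lookup; split.
  - intros K; apply H in K as [[i s] E]; cbn in E; split.
    + apply memV_element; now exists i.
    + apply (projT2 (S i)) in s; transport_sat s.
  - intros [K s]; apply memV_element in K as [i E]; apply H.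
    assert (s' : @sat (V_structure U M) (update (update ρ u a) x (element a i)) φ)
      by transport_sat s.
    apply (projT2 (S i)) in s'; now exists (existT _ i s').
Qed.

(** Subset collection needs only the images of functions from a to b. *)
Lemma valid_subset_collection (U : universe) (M : setoid) (a b c d u x y : var)
    (φ : formula) : NoDup [a; b; c; d; u; x; y] -> ~ free d φ ->
  valid (V_structure U M)
    (∀ a, ∀ b, ∃S c, ∀ u,
       (∀ x ∈ a, ∃ y ∈ b, φ) ⇒
       ∃ d ∈ c, (∀ x ∈ a, ∃ y ∈ d, φ) ∧ (∀ y ∈ d, ∃ x ∈ a, φ)).
Proof.
  intros N Fd ρ; distinct; unfold_sat; intros A B.
  destruct (family_set (T_pi U (index A) (fun _ => index B))
    (fun h => sup (index A) (fun i => element B (h i)))) as [C [HC H]].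
  exists C; lookup; split; [exact HC|]; intros w K.
  (* With ∃ read as Σ, the premise yields a function from indices of [A] to indices of [B]. [C] was
     fixed before the parameter [w], as it holds the images of all such functions. *)
  assert (P : forall i : T (index A), {j : T (index B) &
    @sat (V_structure U M)
      (update (update (update (update (update (update ρ a A) b B) c C) u w)
         x (element A i)) y (element B j)) φ}).
  { intros i; specialize (K (element A i)); lookup.
    destruct (K (element_memV A i)) as [e [He s]]; lookup.
    apply memV_element in He as [j E]; exists j; transport_sat s. }
  exists (sup (index A) (fun i => element B (projT1 (P i)))); lookup.
  split; [apply H; exists (fun i => projT1 (P i)); apply eqV_refl|]; split.
  - intros e He; lookup; apply memV_element in He as [i E].
    exists (element B (projT1 (P i))); lookup.
    split; [exists i; apply eqV_refl|].
    pose proof (projT2 (P i)) as s; transport_sat s.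
  - intros e He; lookup; destruct He as [i E].
    exists (element A i); lookup; split; [apply element_memV|].
    pose proof (projT2 (P i)) as s; transport_sat s.
Qed.

(** The chosen witnesses may lie anywhere in [V], but being indexed by [index A] they form a set,
    and each comes with the index it was chosen for. If [A] is an atom, that set is empty. *)
Lemma valid_strong_collection (U : universe) (M : setoid) (a b x y : var)
    (φ : formula) : NoDup [a; b; x; y] -> ~ free b φ ->
  valid (V_structure U M)
    (∀ a, (∀ x ∈ a, ∃ y, φ) ⇒
       ∃S b, (∀ x ∈ a, ∃ y ∈ b, φ) ∧ (∀ y ∈ b, ∃ x ∈ a, φ)).
Proof.
  intros N Fb ρ; distinct; unfold_sat; intros A K.
  assert (P : forall i : T (index A), {e : V U M &
    @sat (V_structure U M) (update (update (update ρ a A) x (element A i)) y e) φ}).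
  { intros i; apply K; lookup; apply element_memV. }
  exists (sup (index A) (fun i => projT1 (P i))); lookup.
  split; [exact tt|]; split.
  - intros e He; lookup; apply memV_element in He as [i E].
    exists (projT1 (P i)); lookup; split; [exists i; apply eqV_refl|].
    pose proof (projT2 (P i)) as s; transport_sat s.
  - intros e He; lookup; destruct He as [i E].
    exists (element A i); lookup; split; [apply element_memV|].
    pose proof (projT2 (P i)) as s; transport_sat s.
Qed.

Lemma valid_infinity (U : universe) (M : setoid) (x y z w v t : var) :
  NoDup [x; y; z; w; v; t] ->
  valid (V_structure U M)
    (∃S x,
       (∃ z ∈ x, IsSet z ∧ ∀ w, ¬ w ∈ z) ∧
       (∀ y ∈ x, ∃ z ∈ x, IsSet z ∧
          ∀ v, v ∈ z ⇔ (v ≐ y ∨ (IsSet v ∧ ∀ t, t ∈ v ⇔ t ≐ y)))).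
Proof.
  intros N ρ; distinct; unfold_sat.
  destruct (family_set (T_nat U) (@numeral U M)) as [ω [Hω H]].
  exists ω; lookup; split; [exact Hω|]; split.
  - exists emptyV; lookup; split; [apply H; exists 0; apply eqV_refl|].
    split; [apply setV_emptyV|]; intros e; lookup; apply memV_emptyV.
  - intros e He; lookup; apply H in He as [n E].
    exists (numeral (S n)); lookup; split; [apply H; exists (S n); apply eqV_refl|].
    split; [apply setV_pairV|]; intros k; lookup; split.
    + intros K; apply memV_pairV in K as [K | K].
      * left; eauto using eqV_trans, eqV_sym.
      (* [k] equals the singleton of [numeral n]; its description in terms of [e] follows because
         [e] equals [numeral n]. *)
      * right; split; [apply (setV_eqV _ _ (eqV_sym _ _ K)), setV_pairV|].
        intros l; lookup; split.
        -- intros L; apply (memV_eqV l l k _ (eqV_refl l) K) in L.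
           apply memV_pairV in L as [L | L]; eauto using eqV_trans, eqV_sym.
        -- intros L; apply (memV_eqV l l _ k (eqV_refl l) (eqV_sym _ _ K)).
           apply memV_pairV; left; eauto using eqV_trans.
    + intros [K | [K L]]; apply memV_pairV.
      * left; eauto using eqV_trans.
      (* Conversely, the formula determines [k] only through its members, so extensionality
         identifies it with the singleton. *)
      * right; apply eqV_ext; [assumption | apply setV_pairV|].
        intros l; specialize (L l); lookup; split.
        -- intros l_k; apply L in l_k; apply memV_pairV; left; eauto using eqV_trans.
        -- intros l_n; apply L; apply memV_pairV in l_n as [F | F];
             eauto using eqV_trans, eqV_sym.
Qed.

Lemma valid_CZFU (U : universe) (M : setoid) (HM : belongs_to M U) (φ : formula) :
  CZFU φ -> valid (V_structure U M) φ.
Proof.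
  intros [].
  (* The outermost constructor decides whether an object is a set or an atom. *)
  - intros ρ [a f | b]; unfold_sat; lookup; [now left | now right].
  - intros ρ u v; distinct; unfold_sat; lookup; apply memV_setV.
  - now apply valid_extensionality.
  - now apply valid_set_induction.
  - now apply valid_union.
  - now apply valid_pairing.
  - now apply valid_bounded_separation.
  - now apply valid_subset_collection.
  - now apply valid_strong_collection.
  - now apply valid_infinity.
Qed.

Lemma valid_set_of_atoms (U : universe) (M : setoid) (HM : belongs_to M U) (x z : var) :
  x <> z -> valid (V_structure U M) (∃S x, ∀ z, z ∈ x ⇔ IsAtom z).
Proof.
  intros N ρ; unfold_sat; destruct HM as (m & [e _]).
  (* Since the carrier of [M] is the decoding of [m], the constructor [atom] is itself a family
     indexed by a code. *)
  destruct (family_set (eq_sym e) (@atom U M)) as [v [Hv H]].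
  exists v; lookup; split; [exact Hv|]; intros w; lookup; split.
  (* If [w] were a set, then so would be the atom equal to it, and [setV (atom b)] computes to
     [Empty_set]. *)
  - intros K; apply H in K as [b E]; exact (setV_eqV w (atom b) E).
  - destruct w as [a f | b]; intros K; [now destruct K|].
    apply H; exists b; apply eqV_refl.
Qed.

Theorem theorem5p6 (U : universe) (M : setoid) (HM : belongs_to M U)
    (x z : var) (xz : x <> z) :
  (is_model (V_structure U M) *
   valid (V_structure U M) (∃S x, ∀ z, z ∈ x ⇔ IsAtom z)%form)%type.
Proof.
  split; [split|].
  - apply valid_equality.
  - now apply valid_CZFU.
  - now apply valid_set_of_atoms.
Qed.
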